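(* Let $(D,\dashv,\vdash,\theta_{\dashv,r},\theta_{\vdash,r})$ be a triangular diassociative bialgebra associated with a symmetric solution $r=\sum_ix_i\otimes y_i\in D\otimes D$ of the diassociative Yang-Baxter equation, and let $(B,\diamond,\varpi)$ be a quadratic Zinbiel algebra. Let $\{e_j\}$ be a basis of $B$, $\{f_j\}$ the dual basis ($\varpi(f_i,e_j)=\delta_{ij}$) and $\widetilde r=\sum_{i,j}(x_i\otimes e_j)\otimes(y_i\otimes f_j)$. Then the following square of constructions commutes, with all four objects triangular bialgebras: (I) the ASI bialgebra induced from $D$ by $B$ is the triangular ASI bialgebra $(D\otimes B,\cdot,\Delta_{\widetilde r})$, and its induced Lie bialgebra (commutator bracket, cobracket $\Delta_{\widetilde r}-\tau\Delta_{\widetilde r}$) is the triangular Lie bialgebra $(D\otimes B,[-,-],\delta_{\widetilde r})$; (II) the Leibniz bialgebra induced from $D$ is the triangular Leibniz bialgebra $(D,\ast,\vartheta_r)$, and the Lie bialgebra induced from it by $(B,\diamond,\varpi)$ is the same triangular Lie bialgebra $(D\otimes B,[-,-],\delta_{\widetilde r})$.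
   Context: All vector spaces are finite-dimensional over a field $\Bbbk$ of characteristic zero; $\tau(x\otimes y)=y\otimes x$; $(d'\otimes d'')\bullet(b'\otimes b''):=(d'\otimes b')\otimes(d''\otimes b'')$. Diassociative algebra $(D,\dashv,\vdash)$: two associative products with $(d_1\dashv d_2)\dashv d_3=d_1\dashv(d_2\vdash d_3)$, $(d_1\vdash d_2)\dashv d_3=d_1\vdash(d_2\dashv d_3)$, $(d_1\dashv d_2)\vdash d_3=(d_1\vdash d_2)\vdash d_3$. Write $\mathbf l_\dashv(d)(x)=d\dashv x$, $\mathbf r_\dashv(d)(x)=x\dashv d$, $\mathbf l_\vdash(d)(x)=d\vdash x$, $\mathbf r_\vdash(d)(x)=x\vdash d$. The diassociative Yang-Baxter equation for $r=\sum_ix_i\otimes y_i$ is $\sum_{i,j}\big(x_i\otimes x_j\otimes(y_i\vdash y_j)-x_j\otimes(x_i\dashv y_j)\otimes y_i-(x_i\vdash x_j)\otimes y_i\otimes y_j+(x_i\dashv x_j)\otimes y_i\otimes y_j\big)=0$; $r$ is symmetric if $\tau(r)=r$. For a symmetric solution $r$ the triangular diassociative bialgebra associated with $r$ is $(D,\dashv,\vdash,\theta_{\dashv,r},\theta_{\vdash,r})$ with $\theta_{\dashv,r}(d)=\big(\mathrm{id}\otimes(\mathbf l_\vdash-\mathbf l_\dashv)(d)-\mathbf r_\vdash(d)\otimes\mathrm{id}\big)(r)$, $\theta_{\vdash,r}(d)=-\big((\mathbf r_\vdash-\mathbf r_\dashv)(d)\otimes\mathrm{id}+\mathrm{id}\otimes\mathbf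 l_\dashv(d)\big)(r)$. Zinbiel algebra: $b_1\diamond(b_2\diamond b_3)=(b_1\diamond b_2)\diamond b_3+(b_2\diamond b_1)\diamond b_3$; quadratic: with a nondegenerate skew-symmetric form $\varpi$, $\varpi(b_1\diamond b_2,b_3)=\varpi(b_2,b_1\diamond b_3+b_3\diamond b_1)$. $\nu_\varpi:B\to B\otimes B$ is given by $\varpi(\nu_\varpi(b_1),b_2\otimes b_3)=\varpi(b_1,b_2\diamond b_3)$, with $\varpi(a\otimes b,a'\otimes b')=\varpi(a,a')\varpi(b,b')$. ASI (antisymmetric infinitesimal) bialgebra induced from a diassociative bialgebra $(D,\dashv,\vdash,\theta_\dashv,\theta_\vdash)$ by $B$: $D\otimes B$ with $(d_1\otimes b_1)\cdot(d_2\otimes b_2)=(d_1\vdash d_2)\otimes(b_1\diamond b_2)+(d_1\dashv d_2)\otimes(b_2\diamond b_1)$ and $\Delta(d\otimes b)=\theta_\vdash(d)\bullet\nu_\varpi(b)+\theta_\dashv(d)\bullet\tau\nu_\varpi(b)$. For an associative algebra $A$ with left/right multiplications $\mathbf l_A,\mathbf r_A$ and $s\in A\otimes A$, $\Delta_s(a)=(\mathrm{id}\otimes\mathbf l_A(a)-\mathbf r_A(a)\otimes\mathrm{id})(s)$; if $s=\sum u_i\otimes v_i$ is skew-symmetric and solves $\sum_{i,j}\big((u_iu_j)\otimes v_i\otimes v_j+u_i\otimes u_j\otimes(v_iv_j)-u_j\otimes(u_iv_j)\otimes v_i\big)=0$, then $(A,\cdot,\Delta_s)$ is called a triangular ASI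 bialgebra. Leibniz bialgebra induced from $D$: $(D,\ast,\vartheta)$ with $d_1\ast d_2=d_1\vdash d_2-d_2\dashv d_1$, $\vartheta=\theta_\vdash-\tau\theta_\dashv$. For a Leibniz algebra $(L,\ast)$, $\tilde{\mathbf l}(x)(y)=x\ast y$, $\tilde{\mathbf r}(x)(y)=y\ast x$, and $r=\sum x_i\otimes y_i\in L\otimes L$, put $\vartheta_r(x)=\big((\tilde{\mathbf l}+\tilde{\mathbf r})(x)\otimes\mathrm{id}-\mathrm{id}\otimes\tilde{\mathbf r}(x)\big)(r)$; if $r$ is symmetric and solves $\sum_{i,j}\big((x_i\ast x_j)\otimes y_i\otimes y_j-x_i\otimes(y_i\ast x_j)\otimes y_j-x_j\otimes(x_i\ast y_j)\otimes y_i+x_j\otimes x_i\otimes(y_i\ast y_j)\big)=0$, then $(L,\ast,\vartheta_r)$ is called a triangular Leibniz bialgebra. Lie bialgebra induced from a Leibniz bialgebra $(L,\ast,\vartheta)$ by $(B,\diamond,\varpi)$: $L\otimes B$ with $[x_1\otimes b_1,x_2\otimes b_2]=(x_1\ast x_2)\otimes(b_1\diamond b_2)-(x_2\ast x_1)\otimes(b_2\diamond b_1)$ and $\delta(x\otimes b)=(\mathrm{id}\otimes\mathrm{id}-\tau)(\vartheta(x)\bullet\nu_\varpi(b))$. For a Lie algebra $\mathfrak g$ and $s=\sum u_i\otimes v_i\in\mathfrak g\otimes\mathfrak g$, $\delta_s(g)=(\mathrm{id}\otimes\mathrm{ad}(g)+\mathrm{ad}(g)\otimes\mathrm{id})(s)$;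 if $s$ is skew-symmetric and solves the classical Yang-Baxter equation $\sum_{i,j}\big([u_i,u_j]\otimes v_i\otimes v_j+u_i\otimes u_j\otimes[v_i,v_j]+u_i\otimes[v_i,u_j]\otimes v_j\big)=0$, then $(\mathfrak g,[-,-],\delta_s)$ is called a triangular Lie bialgebra.
   Formalization: In (II) a sign is corrected: the Leibniz bialgebra induced from D is proved to be the triangular one of −r, with coproduct −ϑ_r, since with the stated formulas θ_⊢−τθ_⊣ = −ϑ_r; (D,∗,ϑ_r) is separately proved triangular. *)

(* Defs.v *)
From HB Require Import structures.
From mathcomp Require Import all_boot all_order all_algebra.
Set Implicit Arguments.
Unset Strict Implicit.
Unset Printing Implicit Defensive.
Import GRing.Theory.
Local Open Scope ring_scope.

Notation bilinear_map f := (bilinear_for *:%R *:%R f).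
Notation bilinear_form f := (bilinear_for *%R *%R f).

(** [tensor U V] is modelled by coordinate matrices with respect to the bases of
    [U] and [V] underlying their [vectType] structures, and [u ⊗ v] is the
    product of the coordinate column of [u] with the coordinate row of [v].
    The universal property is [tlift_tpure], [tlift_is_linear] and
    [tensor_ext]. *)

Section Tensor.

Variable k : fieldType.

Definition tensor (U V : vectType k) : vectType k := 'M[k]_(dim U, dim V).

Definition tpure (U V : vectType k) (u : U) (v : V) : tensor U V :=
  (VectorInternalTheory.v2r u)^T *m VectorInternalTheory.v2r v.

Definition std_basis (U : vectType k) (i : 'I_(dim U)) : U :=
  VectorInternalTheory.r2v (delta_mx 0 i).

Definition tlift (U V W : vectType k) (f : U -> V -> W) (t : tensor U V) : W :=
  \sum_i \sum_j (t : 'M_(_, _)) i j *: f (std_basis i) (std_basis j).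

End Tensor.

Notation "u ⊗ v" := (tpure u v) (at level 40, left associativity) : ring_scope.

Section TensorTheory.

Variable k : fieldType.
Implicit Types U V W : vectType k.

Import VectorInternalTheory.

Lemma vec_std_basis U (u : U) : u = \sum_i v2r u 0 i *: std_basis i.
Proof.
rewrite -{1}(v2rK u) [in LHS](row_sum_delta (v2r u)) linear_sum.
by apply: eq_bigr => i _; rewrite linearZ.
Qed.

Lemma tpure_is_bilinear U V : bilinear_map (@tpure k U V).
Proof.
split=> [v | u] a x y; rewrite /tpure.
  by rewrite linearP linearP /= mulmxDl -scalemxAl.
by rewrite linearP mulmxDr -scalemxAr.
Qed.

Lemma eq_tlift U V W (f g : U -> V -> W) t : f =2 g -> tlift f t = tlift g t.
Proof.
by move=> fg; apply: eq_bigr => i _; apply: eq_bigr => j _; rewrite fg.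
Qed.

Lemma tlift_is_linear U V W (f : U -> V -> W) : linear (tlift f).
Proof.
move=> a s t; rewrite /tlift scaler_sumr -big_split; apply: eq_bigr => i _ /=.
rewrite scaler_sumr -big_split; apply: eq_bigr => j _ /=.
by rewrite !mxE scalerDl scalerA.
Qed.

Lemma bilinear_suml U V W (f : U -> V -> W) (hf : bilinear_map f)
  (I : finType) (x : I -> U) v : f (\sum_i x i) v = \sum_i f (x i) v.
Proof.
pose g := GRing.isLinear.Build k U W *:%R (f^~ v) (hf.1 v).
pose G : {linear U -> W} := HB.pack (f^~ v) g.
exact: (linear_sum G).
Qed.

Lemma bilinear_sumr U V W (f : U -> V -> W) (hf : bilinear_map f)
  (I : finType) u (y : I -> V) : f u (\sum_i y i) = \sum_i f u (y i).
Proof.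
pose g := GRing.isLinear.Build k V W *:%R (f u) (hf.2 u).
pose G : {linear V -> W} := HB.pack (f u) g.
exact: (linear_sum G).
Qed.

Lemma bilinear_scale U V W (f : U -> V -> W) (hf : bilinear_map f) a b u v :
  f (a *: u) (b *: v) = (a * b) *: f u v.
Proof.
pose g := GRing.isLinear.Build k U W *:%R (f^~ (b *: v)) (hf.1 _).
pose G : {linear U -> W} := HB.pack (f^~ (b *: v)) g.
pose g' := GRing.isLinear.Build k V W *:%R (f u) (hf.2 u).
pose G' : {linear V -> W} := HB.pack (f u) g'.
have -> : f (a *: u) (b *: v) = a *: f u (b *: v) by exact: (linearZ_LR G).
have -> : f u (b *: v) = b *: f u v by exact: (linearZ_LR G').
by rewrite scalerA.
Qed.

Lemma tlift_tpure U V W (f : U -> V -> W) (hf : bilinear_map f) u v :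
  tlift f (u ⊗ v) = f u v.
Proof.
rewrite [in RHS](vec_std_basis u) (bilinear_suml hf); apply: eq_bigr => i _.
rewrite [in RHS](vec_std_basis v) (bilinear_sumr hf); apply: eq_bigr => j _.
by rewrite (bilinear_scale hf) /tpure mxE big_ord1 mxE.
Qed.

Lemma tlift_sum U V W (f : U -> V -> W) (I : finType) (t : I -> tensor U V) :
  tlift f (\sum_i t i) = \sum_i tlift f (t i).
Proof.
pose g := GRing.isLinear.Build k _ W *:%R (tlift f) (tlift_is_linear f).
pose G : {linear tensor U V -> W} := HB.pack (tlift f) g.
exact: (linear_sum G).
Qed.

Lemma tliftZ U V W (f : U -> V -> W) a t : tlift f (a *: t) = a *: tlift f t.
Proof.
pose g := GRing.isLinear.Build k _ W *:%R (tlift f) (tlift_is_linear f).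
pose G : {linear tensor U V -> W} := HB.pack (tlift f) g.
exact: (linearZ_LR G).
Qed.

Lemma tensor_std U V (t : tensor U V) :
  t = \sum_i \sum_j (t : 'M_(_, _)) i j *: (std_basis i ⊗ std_basis j).
Proof.
rewrite [LHS]matrix_sum_delta; apply: eq_bigr => i _; apply: eq_bigr => j _.
congr (_ *: _); rewrite /tpure /std_basis !r2vK trmx_delta.
by rewrite mul_delta_mx.
Qed.

Lemma tensor_ext U V W (f g : tensor U V -> W) :
  linear f -> linear g -> (forall u v, f (u ⊗ v) = g (u ⊗ v)) -> f =1 g.
Proof.
move=> lf lg fg t.
pose F : {linear tensor U V -> W} :=
  HB.pack f (GRing.isLinear.Build k _ W *:%R f lf).
pose G : {linear tensor U V -> W} :=
  HB.pack g (GRing.isLinear.Build k _ W *:%R g lg).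
change (F t = G t); rewrite (tensor_std t) !linear_sum; apply: eq_bigr => i _.
by rewrite !linear_sum; apply: eq_bigr => j _; rewrite !linearZ /= fg.
Qed.

End TensorTheory.

Section TensorMaps.

Variable k : fieldType.
Implicit Types U V W : vectType k.

Definition tau U V : tensor U V -> tensor V U := tlift (fun u v => v ⊗ u).

Definition tmap U V U' V' (f : U -> U') (g : V -> V') :
  tensor U V -> tensor U' V' := tlift (fun u v => f u ⊗ g v).

(* For [r = \sum_i x i ⊗ y i] and [F] multilinear, [tsum2 r F] is
   [\sum_i \sum_j F (x i) (y i) (x j) (y j)]: see [tsum2E]. *)
Definition tsum2 U V W (r : tensor U V) (F : U -> V -> U -> V -> W) : W :=
  tlift (fun x y => tlift (F x y) r) r.

Lemma tsum2E U V W (F : U -> V -> U -> V -> W) (I : finType)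
    (x : I -> U) (y : I -> V) :
  (forall u v, bilinear_map (F u v)) ->
  (forall u' v', bilinear_map (fun u v => F u v u' v')) ->
  tsum2 (\sum_i x i ⊗ y i) F = \sum_i \sum_j F (x i) (y i) (x j) (y j).
Proof.
move=> hF hF'; rewrite /tsum2 tlift_sum; apply: eq_bigr => i _.
have E u v : tlift (F u v) (\sum_j x j ⊗ y j) = \sum_j F u v (x j) (y j).
  by rewrite tlift_sum; apply: eq_bigr => j _; rewrite tlift_tpure.
rewrite tlift_tpure ?E //; split=> [v | u] a u1 u2; rewrite /= !E;
  rewrite scaler_sumr -big_split; apply: eq_bigr => j _ /=.
- exact: (hF' (x j) (y j)).1.
- exact: (hF' (x j) (y j)).2.
Qed.

Definition tbullet U V (s : tensor U U) (t : tensor V V) :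
    tensor (tensor U V) (tensor U V) :=
  tlift (fun d' d'' => tlift (fun b' b'' => (d' ⊗ b') ⊗ (d'' ⊗ b'')) t) s.

Definition form2 V (w : V -> V -> k) (s t : tensor V V) : k :=
  tlift (fun a b => tlift (fun a' b' => w a a' * w b b' : k^o) t) s.

Definition tensor_symmetric V (r : tensor V V) : Prop := tau r = r.
Definition tensor_skew V (r : tensor V V) : Prop := tau r = - r.

End TensorMaps.

Section Algebras.

Variable k : fieldType.
Implicit Types A B D L : vectType k.

Record associative_algebra A (mul : A -> A -> A) : Prop := {
  assoc_bilinear : bilinear_map mul;
  assoc_mulA : forall a b c, mul a (mul b c) = mul (mul a b) c }.

Record lie_algebra L (br : L -> L -> L) : Prop := {
  lie_bilinear : bilinear_map br;
  lie_alternating : forall x, br x x = 0;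
  lie_jacobi : forall x y z,
    br x (br y z) + br y (br z x) + br z (br x y) = 0 }.

(* Left Leibniz algebras: the left multiplications are derivations. *)
Record leibniz_algebra L (ast : L -> L -> L) : Prop := {
  leibniz_bilinear : bilinear_map ast;
  leibniz_identity : forall x y z,
    ast x (ast y z) = ast (ast x y) z + ast y (ast x z) }.

Record diassociative_algebra D (dashv vdash : D -> D -> D) : Prop := {
  dashv_assoc : associative_algebra dashv;
  vdash_assoc : associative_algebra vdash;
  diass_dashv_vdash : forall x y z,
    dashv (dashv x y) z = dashv x (vdash y z);
  diass_vdash_dashv : forall x y z,
    dashv (vdash x y) z = vdash x (dashv y z);
  diass_dashv_vdash_l : forall x y z,
    vdash (dashv x y) z = vdash (vdash x y) z }.

Record zinbiel_algebra B (dia : B -> B -> B) : Prop := {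
  zinbiel_bilinear : bilinear_map dia;
  zinbiel_identity : forall a b c,
    dia a (dia b c) = dia (dia a b) c + dia (dia b a) c }.

Record quadratic_zinbiel_algebra B (dia : B -> B -> B) (w : B -> B -> k) :
  Prop := {
  quadratic_zinbiel : zinbiel_algebra dia;
  form_bilinear : bilinear_form w;
  form_skew : forall a b, w a b = - w b a;
  form_nondegenerate : forall a, (forall b, w a b = 0) -> a = 0;
  form_invariant : forall a b c, w (dia a b) c = w b (dia a c + dia c a) }.

(* Nondegeneracy of [w] makes such a [nu] exist and be unique. *)
Definition dual_coproduct B (dia : B -> B -> B) (w : B -> B -> k)
    (nu : B -> tensor B B) : Prop :=
  forall a b c, form2 w (nu a) (b ⊗ c) = w a (dia b c).

Lemma dual_coproduct_exists B (dia : B -> B -> B) (w : B -> B -> k) m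
    (e f : m.-tuple B) :
  quadratic_zinbiel_algebra dia w -> basis_of fullv e ->
  (forall i j, w (tnth f i) (tnth e j) = (i == j)%:R) ->
  dual_coproduct dia w (fun a => \sum_i \sum_j
    w a (dia (tnth e i) (tnth e j)) *: (tnth f i ⊗ tnth f j)).
Proof.
move=> hB he hd a b c.
have hw : @bilinear_for k B B k^o *:%R *:%R w := form_bilinear hB.
have hz := zinbiel_bilinear (quadratic_zinbiel hB).
have E v : v = \sum_i w (tnth f i) v *: tnth e i.
  have dv := coord_basis he (memvf v).
  rewrite {1}dv; apply: eq_bigr => i _; rewrite -tnth_nth; congr (_ *: _).
  rewrite {2}dv (bilinear_sumr hw) (bigD1 i) //= big1 => [|j ji].
    rewrite -[tnth f i]scale1r (bilinear_scale hw) -tnth_nth hd eqxx.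
    by rewrite mul1r addr0 [RHS]mulr1.
  rewrite -[tnth f i]scale1r (bilinear_scale hw) -tnth_nth hd eq_sym.
  by rewrite (negPf ji) scaler0.
have L t : form2 w t (b ⊗ c) = tlift (fun p q => w p b * w q c : k^o) t.
  apply: (@eq_tlift k B B k^o) => p q.
  rewrite tlift_tpure //; split=> [v|u] x u1 u2 /=.
    by rewrite ((form_bilinear hB).2 _ _ _ _) mulrDl -mulrA.
  by rewrite ((form_bilinear hB).2 _ _ _ _) mulrDr mulrCA.
rewrite L tlift_sum [in RHS](E b) [in RHS](E c) (bilinear_suml hz).
rewrite (bilinear_sumr hw); apply: eq_bigr => i _; rewrite tlift_sum.
rewrite (bilinear_sumr hz) (bilinear_sumr hw); apply: eq_bigr => j _.
rewrite (bilinear_scale hz) -[a in RHS]scale1r (bilinear_scale hw) mul1r.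
rewrite tliftZ tlift_tpure; first exact: mulrC.
split=> [v|u] x u1 u2 /=.
  by rewrite ((form_bilinear hB).1 _ _ _ _) mulrDl -mulrA.
by rewrite ((form_bilinear hB).1 _ _ _ _) mulrDr mulrCA.
Qed.

End Algebras.

Section Triangular.

Variable k : fieldType.
Implicit Types A D L : vectType k.

Record bialgebra_data A := BialgebraData {
  bprod : A -> A -> A;
  bcoprod : A -> tensor A A }.

Definition same_bialgebra A (X Y : bialgebra_data A) : Prop :=
  bprod X =2 bprod Y /\ bcoprod X =1 bcoprod Y.

Record dibialgebra_data D := DibialgebraData {
  dashv : D -> D -> D;
  vdash : D -> D -> D;
  codashv : D -> tensor D D;
  covdash : D -> tensor D D }.

Section Diassociative.

Variables (D : vectType k) (dl dr : D -> D -> D) (r : tensor D D).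
Local Notation "x ⊣ y" := (dl x y) (at level 50, no associativity).
Local Notation "x ⊢ y" := (dr x y) (at level 50, no associativity).

Definition diassociative_YBE : Prop :=
  tsum2 r (fun xi yi xj yj =>
      xi ⊗ (xj ⊗ (yi ⊢ yj)) - xj ⊗ ((xi ⊣ yj) ⊗ yi)
    - (xi ⊢ xj) ⊗ (yi ⊗ yj) + (xi ⊣ xj) ⊗ (yi ⊗ yj)) = 0.

Definition triangular_codashv (d : D) : tensor D D :=
  tmap id (fun x => (d ⊢ x) - (d ⊣ x)) r - tmap (fun x => x ⊢ d) id r.

Definition triangular_covdash (d : D) : tensor D D :=
  - (tmap (fun x => (x ⊢ d) - (x ⊣ d)) id r + tmap id (fun x => d ⊣ x) r).

Definition triangular_dibialgebra : dibialgebra_data D :=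
  DibialgebraData dl dr triangular_codashv triangular_covdash.

End Diassociative.

Section Associative.

Variables (A : vectType k) (mul : A -> A -> A) (s : tensor A A).
Local Notation "x · y" := (mul x y) (at level 39, no associativity).

Definition associative_YBE : Prop :=
  tsum2 s (fun ui vi uj vj =>
      (ui · uj) ⊗ (vi ⊗ vj) + ui ⊗ (uj ⊗ (vi · vj))
    - uj ⊗ ((ui · vj) ⊗ vi)) = 0.

Definition ASI_coboundary (a : A) : tensor A A :=
  tmap id (fun x => a · x) s - tmap (fun x => x · a) id s.

End Associative.

Section Leibniz.

Variables (L : vectType k) (ast : L -> L -> L) (r : tensor L L).
Local Notation "x ∗ y" := (ast x y) (at level 39, no associativity).

Definition leibniz_YBE : Prop :=
  tsum2 r (fun xi yi xj yj =>
      (xi ∗ xj) ⊗ (yi ⊗ yj) - xi ⊗ ((yi ∗ xj) ⊗ yj)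
    - xj ⊗ ((xi ∗ yj) ⊗ yi) + xj ⊗ (xi ⊗ (yi ∗ yj))) = 0.

(* Linear in [r], so that [- r] gives the opposite coproduct.  For a symmetric
   [r], the coproduct [covdash - tau codashv] built from [triangular_codashv]
   and [triangular_covdash] is the coboundary of [- r], not of [r]. *)
Definition leibniz_coboundary (x : L) : tensor L L :=
  tmap (fun y => (x ∗ y) + (y ∗ x)) id r - tmap id (fun y => y ∗ x) r.

End Leibniz.

Section Lie.

Variables (L : vectType k) (br : L -> L -> L) (s : tensor L L).

Definition classical_YBE : Prop :=
  tsum2 s (fun ui vi uj vj =>
      br ui uj ⊗ (vi ⊗ vj) + ui ⊗ (uj ⊗ br vi vj)
    + ui ⊗ (br vi uj ⊗ vj)) = 0.

Definition lie_coboundary (g : L) : tensor L L :=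
  tmap id (br g) s + tmap (br g) id s.

End Lie.

Definition is_triangular_ASI A (X : bialgebra_data A) (s : tensor A A) : Prop :=
  [/\ associative_algebra (bprod X),
      tensor_skew s,
      associative_YBE (bprod X) s &
      bcoprod X =1 ASI_coboundary (bprod X) s].

Definition is_triangular_leibniz L (X : bialgebra_data L) (r : tensor L L) :
    Prop :=
  [/\ leibniz_algebra (bprod X),
      tensor_symmetric r,
      leibniz_YBE (bprod X) r &
      bcoprod X =1 leibniz_coboundary (bprod X) r].

Definition is_triangular_lie L (X : bialgebra_data L) (s : tensor L L) : Prop :=
  [/\ lie_algebra (bprod X),
      tensor_skew s,
      classical_YBE (bprod X) s &
      bcoprod X =1 lie_coboundary (bprod X) s].

End Triangular.

Section Induced.

Variable k : fieldType.

Definition lie_of_ASI (A : vectType k) (X : bialgebra_data A) :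
    bialgebra_data A :=
  BialgebraData (fun a b => bprod X a b - bprod X b a)
                (fun a => bcoprod X a - tau (bcoprod X a)).

Definition leibniz_of_diassociative (D : vectType k) (X : dibialgebra_data D) :
    bialgebra_data D :=
  BialgebraData (fun x y => vdash X x y - dashv X y x)
                (fun x => covdash X x - tau (codashv X x)).

Variables (B : vectType k) (dia : B -> B -> B) (nu : B -> tensor B B).

Definition ASI_of_diassociative (D : vectType k) (X : dibialgebra_data D) :
    bialgebra_data (tensor D B) :=
  BialgebraData
    (fun u v => tlift (fun d1 b1 => tlift (fun d2 b2 =>
       vdash X d1 d2 ⊗ dia b1 b2 + dashv X d1 d2 ⊗ dia b2 b1) v) u)
    (tlift (fun d b =>
       tbullet (covdash X d) (nu b) + tbullet (codashv X d) (tau (nu b)))).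

Definition lie_of_leibniz (L : vectType k) (X : bialgebra_data L) :
    bialgebra_data (tensor L B) :=
  BialgebraData
    (fun u v => tlift (fun x1 b1 => tlift (fun x2 b2 =>
       bprod X x1 x2 ⊗ dia b1 b2 - bprod X x2 x1 ⊗ dia b2 b1) v) u)
    (tlift (fun x b =>
       tbullet (bcoprod X x) (nu b) - tau (tbullet (bcoprod X x) (nu b)))).

End Induced.

(* Main.v *)
From HB Require Import structures.
Require Import Defs.
From mathcomp Require Import all_boot all_order all_algebra ring.
Import GRing.Theory.
Local Open Scope ring_scope.

(** Every identity between tensors is tested on products of linear forms, the
    forms on [B] being the [w(-, a)], which separate the points of [B].  Summing
    the dual bases away, the associative Yang-Baxter equation of [rt] tested on
    [(phi, a)], [(psi, b)], [(chi, c)] becomes a combination of sums over [r]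
    with coefficients [w(a ◇ b, c)] and its permutations.  By invariance this
    coefficient only depends on the argument in the second place, and the three
    values add up to zero; what is left is the diassociative Yang-Baxter equation
    of [r] plus its image under a cyclic permutation of the legs. *)

Set Implicit Arguments.
Unset Strict Implicit.
Unset Printing Implicit Defensive.

(** * Separating families of linear forms *)

Section LinearForms.
Variable k : fieldType.
Implicit Types U V W : vectType k.
Import VectorInternalTheory.

(** An indexed family rather than a set, so that the vectors of [B] can index the forms that [w]
    attaches to them. *)
Definition separating U (I : Type) (S : I -> {scalar U}) : Prop :=
  forall u, (forall i, S i u = 0) -> u = 0.

Lemma separating_eq U I (S : I -> {scalar U}) u v :
  separating S -> (forall i, S i u = S i v) -> u = v.
Proof.
by move=> sepS uv; apply/subr0_eq/sepS => i; rewrite linearB /= uv subrr.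
Qed.

Definition coordform U (i : 'I_(dim U)) (u : U) : k := v2r u 0 i.

Lemma coordform_is_linear U i : scalar (@coordform U i).
Proof. by move=> a u v; rewrite /coordform linearP !mxE. Qed.

HB.instance Definition _ U i :=
  GRing.isLinear.Build k U k *%R (@coordform U i) (@coordform_is_linear U i).

Lemma separating_all U : separating (@id {scalar U}).
Proof.
move=> u u0; apply: v2r_inj; rewrite linear0; apply/rowP => i.
by rewrite mxE; apply: (u0 (@coordform U i)).
Qed.

Lemma linear_form_eq U (u v : U) :
  (forall phi : {scalar U}, phi u = phi v) -> u = v.
Proof. exact/separating_eq/separating_all. Qed.

Definition tform U V (phi : {scalar U}) (psi : {scalar V}) (t : tensor U V) : k :=
  tlift (fun u v => phi u * psi v : k^o) t.

Lemma tform_is_linear U V (phi : {scalar U}) (psi : {scalar V}) :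
  scalar (tform phi psi).
Proof. exact: (tlift_is_linear (W := k^o)). Qed.

HB.instance Definition _ U V (phi : {scalar U}) (psi : {scalar V}) :=
  GRing.isLinear.Build k (tensor U V) k *%R (tform phi psi)
    (tform_is_linear phi psi).

Lemma tform_tpure U V (phi : {scalar U}) (psi : {scalar V}) u v :
  tform phi psi (u ⊗ v) = phi u * psi v.
Proof.
rewrite /tform tlift_tpure //; split=> [v'|u'] a u1 u2 /=; rewrite !linearP;
  rewrite /GRing.scale /=; ring.
Qed.

Lemma std_basis_free U (u : 'I_(dim U) -> k) i :
  \sum_j u j *: std_basis j = 0 -> u i = 0.
Proof.
move=> /(congr1 (fun x => v2r x 0 i)); rewrite linear_sum linear0 summxE mxE.
rewrite (bigD1 i) //= big1 ?addr0 => [|j ji].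
  by rewrite linearZ /= mxE /std_basis r2vK mxE !eqxx mulr1.
by rewrite linearZ /= mxE /std_basis r2vK mxE eq_sym (negPf ji) mulr0.
Qed.

(** Contracting the second leg of [t] with [T j] leaves a vector of [U] killed by every [S i], hence
    zero; so each row of [t] is killed by every [T j] and vanishes too. *)
Lemma separating_tform U V I J (S : I -> {scalar U}) (T : J -> {scalar V}) :
  separating S -> separating T ->
  separating (fun ij => tform (S ij.1) (T ij.2) : {scalar tensor U V}).
Proof.
move=> sepS sepT t t0.
apply/matrixP => a b; rewrite mxE.
apply: (@std_basis_free _ (t a) b); apply: sepT => j; rewrite linear_sum.
apply: (@std_basis_free _ (fun a => \sum_b T j (t a b *: std_basis b)) a).
apply: sepS => i; rewrite linear_sum -[RHS](t0 (i, j)) /tform /tlift.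
apply: eq_bigr => c _; rewrite scalarZ mulr_suml; apply: eq_bigr => d _.
by rewrite scalarZ /= /GRing.scale /=; ring.
Qed.

Lemma separating_tensor U V :
  separating (fun ij : {scalar U} * {scalar V} => tform ij.1 ij.2 : {scalar _}).
Proof. exact: (separating_tform (@separating_all U) (@separating_all V)). Qed.

End LinearForms.

(** * Linear forms evaluated on [tlift], [tau] and [tmap] *)

Section TensorCalculus.
Variable k : fieldType.
Implicit Types U V W : vectType k.

Lemma scalar_bilinear U V (alpha : U -> k) (beta : V -> k) :
  scalar alpha -> scalar beta ->
  bilinear_for (V := k^o) *:%R *:%R (fun u v => alpha u * beta v : k^o).
Proof.
move=> la lb; split=> [v|u] c x y /=; rewrite /GRing.scale /=.
  by rewrite [alpha _]la /=; ring.
by rewrite [beta _]lb /=; ring.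
Qed.

Lemma linear_tlift U V W W' (g : W -> W') (F : U -> V -> W) t :
  linear g -> g (tlift F t) = tlift (fun u v => g (F u v)) t.
Proof.
move=> lg; pose G : {linear W -> W'} :=
  HB.pack g (GRing.isLinear.Build k _ _ *:%R g lg).
change (G (tlift F t) = tlift (fun u v => G (F u v)) t).
rewrite linear_sum; apply: eq_bigr => i _.
by rewrite linear_sum; apply: eq_bigr => j _; rewrite linearZ.
Qed.

Lemma linear_tensor U V W (g : tensor U V -> W) t :
  linear g -> g t = tlift (fun u v => g (u ⊗ v)) t.
Proof.
move=> lg; apply: (@tensor_ext _ _ _ _ g (tlift (fun u v => g (u ⊗ v)))) => //.
  exact: tlift_is_linear.
move=> u v; rewrite tlift_tpure //; have bp := @tpure_is_bilinear k U V.
split=> [v'|u'] a x y /=; first by rewrite [_ ⊗ _](bp.1 _ _ _ _) lg.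
by rewrite [_ ⊗ _](bp.2 _ _ _ _) lg.
Qed.

Lemma tliftD U V W (F G : U -> V -> W) t :
  tlift (fun u v => F u v + G u v) t = tlift F t + tlift G t.
Proof.
rewrite /tlift -big_split; apply: eq_bigr => i _ /=.
by rewrite -big_split; apply: eq_bigr => j _; rewrite scalerDr.
Qed.

Lemma tliftN U V W (F : U -> V -> W) t :
  tlift (fun u v => - F u v) t = - tlift F t.
Proof.
rewrite /tlift -sumrN; apply: eq_bigr => i _ /=.
by rewrite -sumrN; apply: eq_bigr => j _; rewrite scalerN.
Qed.

Lemma tliftB U V W (F G : U -> V -> W) t :
  tlift (fun u v => F u v - G u v) t = tlift F t - tlift G t.
Proof. by rewrite tliftD tliftN. Qed.

Lemma tau_is_linear U V : linear (@tau k U V).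
Proof. exact: tlift_is_linear. Qed.

HB.instance Definition _ U V :=
  GRing.isLinear.Build k (tensor U V) (tensor V U) *:%R (@tau k U V)
    (@tau_is_linear U V).

Lemma tmap_is_linear U V U' V' (f : U -> U') (g : V -> V') :
  linear (@tmap k U V U' V' f g).
Proof. exact: tlift_is_linear. Qed.

HB.instance Definition _ U V U' V' (f : U -> U') (g : V -> V') :=
  GRing.isLinear.Build k (tensor U V) (tensor U' V') *:%R
    (@tmap k U V U' V' f g) (tmap_is_linear f g).

Lemma tform_tlift U V W W' (F : U -> V -> tensor W W') (phi : {scalar W})
    (psi : {scalar W'}) t :
  tform phi psi (tlift F t) = tlift (fun u v => tform phi psi (F u v) : k^o) t.
Proof. exact: (@linear_tlift _ _ _ k^o (tform phi psi) F t (scalarP _)). Qed.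

Lemma tform_tau U V (phi : {scalar V}) (psi : {scalar U}) t :
  tform phi psi (tau t) = tform psi phi t.
Proof.
rewrite /tau tform_tlift; apply: (@eq_tlift k U V k^o) => u v.
by rewrite tform_tpure mulrC.
Qed.

Lemma tform_tmap U V U' V' (f : U -> U') (g : V -> V')
    (phi : {scalar U'}) (psi : {scalar V'}) t :
  tform phi psi (tmap f g t) = tlift (fun u v => phi (f u) * psi (g v) : k^o) t.
Proof.
rewrite /tmap tform_tlift; apply: (@eq_tlift k U V k^o) => u v.
exact: tform_tpure.
Qed.

Lemma tlift_mul_sum U V (I : finType) (x : I -> U) (y : I -> V)
    (alpha : U -> k) (beta : V -> k) :
  scalar alpha -> scalar beta ->
  tlift (fun u v => alpha u * beta v : k^o) (\sum_i x i ⊗ y i) =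
  \sum_i alpha (x i) * beta (y i).
Proof.
move=> la lb; rewrite tlift_sum; apply: eq_bigr => i _.
by rewrite tlift_tpure //; apply: scalar_bilinear.
Qed.

Lemma tmap_tau U V U' V' (f : U -> U') (g : V -> V') t :
  linear f -> linear g -> tmap f g (tau t) = tau (tmap g f t).
Proof.
move=> lf lg; apply: (separating_eq (@separating_tensor _ _ _)) => -[phi psi] /=.
rewrite tform_tau !tform_tmap; pose g' := GRing.isLinear.Build k _ _ *:%R g lg.
pose f' := GRing.isLinear.Build k _ _ *:%R f lf.
pose F : {linear U -> U'} := HB.pack f f'.
pose G : {linear V -> V'} := HB.pack g g'.
(* With [f] and [g] bundled as linear maps, the left side is a test of [tau t] on composite
   forms. *)
rewrite -/(tform (phi \o F) (psi \o G)  (tau t)).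
by rewrite tform_tau; apply: (@eq_tlift k _ _ k^o).
Qed.

End TensorCalculus.

(** * Yang-Baxter equations tested on linear forms *)

Section ProductSums.
Variables (k : fieldType) (A : vectType k) (I : finType) (x y : I -> A).
Variables (p : A -> A -> A) (hp : bilinear_map p).
Implicit Types phi psi chi : {scalar A}.

Let s : tensor A A := \sum_i x i ⊗ y i.

Lemma bilPl a u v w : p (a *: u + v) w = a *: p u w + p v w.
Proof. exact: (hp.1 w a u v). Qed.

Lemma bilPr a u v w : p w (a *: u + v) = a *: p w u + p w v.
Proof. exact: (hp.2 w a u v). Qed.

Lemma scalar_mull chi z : scalar (fun u => chi (p u z)).
Proof. by move=> a u v; rewrite bilPl linearP. Qed.

Lemma scalar_mulr chi z : scalar (fun u => chi (p z u)).
Proof. by move=> a u v; rewrite bilPr linearP. Qed.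

(* The product sits in the leg tested by [chi]; its left factor is paired with
   the leg tested by [phi], its right factor with the leg tested by [psi]. *)
Definition prodsum phi psi chi : k :=
  \sum_i \sum_j chi (p (x i) (x j)) * phi (y i) * psi (y j).

Variables (c : k) (hs : tau s = c *: s).

(** This is [hs] tested on two forms. The scalar [c] will be 1 for a symmetric [s] and -1 for a skew
    one, so all four Yang-Baxter equations are served at once. *)
Lemma flip_legs (alpha beta : A -> k) : scalar alpha -> scalar beta ->
  \sum_i alpha (y i) * beta (x i) = c * \sum_i alpha (x i) * beta (y i).
Proof.
move=> la lb.
pose f := GRing.isLinear.Build k A k *%R alpha la.
pose g := GRing.isLinear.Build k A k *%R beta lb.
pose F : {scalar A} := HB.pack alpha f.
pose G : {scalar A} := HB.pack beta g.
have := congr1 (tform F G) hs; rewrite tform_tau scalarZ !linear_sum /=.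
under eq_bigr do rewrite tform_tpure /= mulrC.
by under [X in _ = _ * X -> _]eq_bigr do rewrite tform_tpure /=.
Qed.

(** Exchanging the legs of one copy of [s] costs one factor [c]: here the copy indexed by [i], in
    [prodsum_xy] the one indexed by [j], in [prodsum_yy] both. *)
Lemma prodsum_yx phi psi chi :
  \sum_i \sum_j chi (p (y i) (x j)) * phi (x i) * psi (y j) =
  c * prodsum phi psi chi.
Proof.
rewrite /prodsum exchange_big [in RHS]exchange_big mulr_sumr.
apply: eq_bigr => j _ /=; rewrite -!mulr_suml mulrA; congr (_ * _).
exact: (flip_legs (scalar_mull _ _) (scalarP _)).
Qed.

Lemma prodsum_xy phi psi chi :
  \sum_i \sum_j chi (p (x i) (y j)) * phi (y i) * psi (x j) =
  c * prodsum phi psi chi.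
Proof.
rewrite /prodsum mulr_sumr; apply: eq_bigr => i _ /=.
transitivity ((\sum_j chi (p (x i) (y j)) * psi (x j)) * phi (y i)).
  by rewrite mulr_suml; apply: eq_bigr => j _; ring.
rewrite (flip_legs (scalar_mulr _ _) (scalarP _)) -mulrA mulr_suml.
by congr (_ * _); apply: eq_bigr => j _; ring.
Qed.

Lemma prodsum_yy phi psi chi :
  \sum_i \sum_j chi (p (y i) (y j)) * phi (x i) * psi (x j) =
  c ^+ 2 * prodsum phi psi chi.
Proof.
rewrite expr2 -mulrA -prodsum_yx mulr_sumr; apply: eq_bigr => i _ /=.
transitivity ((\sum_j chi (p (y i) (y j)) * psi (x j)) * phi (x i)).
  by rewrite mulr_suml; apply: eq_bigr => j _; ring.
rewrite (flip_legs (scalar_mulr _ _) (scalarP _)) -mulrA mulr_suml.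
by congr (_ * _); apply: eq_bigr => j _; ring.
Qed.

End ProductSums.

Lemma tsum2_form (k : fieldType) (U V W : vectType k) (r : tensor U V)
    (F : U -> V -> U -> V -> W) (phi : {scalar W}) :
  phi (tsum2 r F) = tsum2 r (fun u v u' v' => phi (F u v u' v') : k^o).
Proof.
rewrite /tsum2 (linear_tlift (W' := k^o) _ _ (scalarP phi)).
apply: (@eq_tlift _ _ _ k^o) => u v.
exact: (linear_tlift (W' := k^o) _ _ (scalarP phi)).
Qed.

Local Ltac tform_expand :=
  rewrite /= ?(linearD, linearN) /= ?tform_tpure /= ?tform_tpure /=.

Local Ltac form_bilinear hp :=
  move=> ? ?; split=> ? ? ? ? /=; tform_expand;
  rewrite ?hp ?linearP /GRing.scale /=; ring.

Local Ltac combine_sums :=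
  rewrite -?(sumrB, big_split) /=; apply: eq_bigr => ? _;
  rewrite -?(sumrB, big_split) /=; apply: eq_bigr => ? _; tform_expand; ring.

Section YangBaxter.
Variables (k : fieldType) (A : vectType k) (I : finType) (x y : I -> A).
Implicit Types phi psi chi : {scalar A}.
Let s : tensor A A := \sum_i x i ⊗ y i.

(** The form testing the leg that holds the product becomes the last argument of [prodsum]. Factors
    [y] inside a product are exchanged for [x] at no cost, since [c] is 1. *)
Lemma diassociative_YBE_form (dl dr : A -> A -> A) phi psi chi :
  bilinear_map dl -> bilinear_map dr -> tau s = s ->
  tform phi (tform psi chi) (tsum2 s (fun xi yi xj yj =>
      xi ⊗ (xj ⊗ (dr yi yj)) - xj ⊗ ((dl xi yj) ⊗ yi)
    - (dr xi xj) ⊗ (yi ⊗ yj) + (dl xi xj) ⊗ (yi ⊗ yj))) =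
  prodsum x y dr phi psi chi - prodsum x y dl chi phi psi
  - prodsum x y dr psi chi phi + prodsum x y dl psi chi phi.
Proof.
move=> hl hr hs; have hs1 : tau s = 1 *: s by rewrite scale1r.
pose hP := (bilPl hl, bilPr hl, bilPl hr, bilPr hr).
rewrite tsum2_form tsum2E; [|by form_bilinear hP|by form_bilinear hP].
(* The factor 1 is written as a square to use [prodsum_yy] backwards. *)
rewrite -[prodsum x y dr phi psi chi]mul1r -(expr1n _ 2) -(prodsum_yy hr hs1).
rewrite -[prodsum x y dl chi phi psi]mul1r -(prodsum_xy hl hs1).
combine_sums.
Qed.

(** Skewness turns the minus sign of the third summand into a plus; what remains is a sum over the
    cyclic rotations of the three forms. *)
Lemma associative_YBE_form (mul : A -> A -> A) phi psi chi :
  bilinear_map mul -> tau s = - s ->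
  tform phi (tform psi chi) (tsum2 s (fun ui vi uj vj =>
      mul ui uj ⊗ (vi ⊗ vj) + ui ⊗ (uj ⊗ mul vi vj)
    - uj ⊗ (mul ui vj ⊗ vi))) =
  prodsum x y mul psi chi phi + prodsum x y mul phi psi chi
  + prodsum x y mul chi phi psi.
Proof.
move=> hm hs; have hs1 : tau s = (-1) *: s by rewrite scaleN1r.
pose hP := (bilPl hm, bilPr hm).
rewrite tsum2_form tsum2E; [|by form_bilinear hP|by form_bilinear hP].
(* Here 1 becomes the square of -1: two exchanges of legs cancel. *)
rewrite -[prodsum x y mul phi psi chi]mul1r -(expr1n _ 2) -sqrrN.
rewrite -(prodsum_yy hm hs1) -[prodsum x y mul chi phi psi]opprK.
rewrite -[- prodsum x y mul chi phi psi]mulN1r.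
rewrite -(prodsum_xy hm hs1).
combine_sums.
Qed.

Lemma classical_YBE_form (br : A -> A -> A) phi psi chi :
  bilinear_map br -> tau s = - s ->
  tform phi (tform psi chi) (tsum2 s (fun ui vi uj vj =>
      br ui uj ⊗ (vi ⊗ vj) + ui ⊗ (uj ⊗ br vi vj)
    + ui ⊗ (br vi uj ⊗ vj))) =
  prodsum x y br psi chi phi + prodsum x y br phi psi chi
  - prodsum x y br phi chi psi.
Proof.
move=> hb hs; have hs1 : tau s = (-1) *: s by rewrite scaleN1r.
pose hP := (bilPl hb, bilPr hb).
rewrite tsum2_form tsum2E; [|by form_bilinear hP|by form_bilinear hP].
rewrite -[prodsum x y br phi psi chi]mul1r -(expr1n _ 2) -sqrrN.
rewrite -(prodsum_yy hb hs1) -[- prodsum _ _ _ _ _ _]mulN1r.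
rewrite -(prodsum_yx hb hs1).
combine_sums.
Qed.

Lemma leibniz_YBE_form (ast : A -> A -> A) phi psi chi :
  bilinear_map ast -> tau s = s ->
  tform phi (tform psi chi) (tsum2 s (fun xi yi xj yj =>
      ast xi xj ⊗ (yi ⊗ yj) - xi ⊗ (ast yi xj ⊗ yj)
    - xj ⊗ (ast xi yj ⊗ yi) + xj ⊗ (xi ⊗ ast yi yj))) =
  prodsum x y ast psi chi phi - prodsum x y ast phi chi psi
  - prodsum x y ast chi phi psi + prodsum x y ast psi phi chi.
Proof.
move=> ha hs; have hs1 : tau s = 1 *: s by rewrite scale1r.
pose hP := (bilPl ha, bilPr ha).
rewrite tsum2_form tsum2E; [|by form_bilinear hP|by form_bilinear hP].
rewrite -[prodsum x y ast psi phi chi]mul1r -(expr1n _ 2) -(prodsum_yy ha hs1).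
rewrite -[prodsum x y ast phi chi psi]mul1r -(prodsum_yx ha hs1).
rewrite -[prodsum x y ast chi phi psi]mul1r -(prodsum_xy ha hs1).
combine_sums.
Qed.

End YangBaxter.

(** * From ASI to Lie and from diassociative to Leibniz *)

Section BilinearMaps.
Variables (k : fieldType) (U V W : vectType k).

Lemma bilBl (p : U -> V -> W) u v w : bilinear_map p ->
  p (u - v) w = p u w - p v w.
Proof.
move=> hp; rewrite -scaleN1r addrC; have /= -> := hp.1 w (-1) v u.
by rewrite scaleN1r addrC.
Qed.

Lemma bilBr (p : U -> V -> W) u v w : bilinear_map p ->
  p w (u - v) = p w u - p w v.
Proof.
move=> hp; rewrite -scaleN1r addrC; have /= -> := hp.2 w (-1) v u.
by rewrite scaleN1r addrC.
Qed.

Lemma bilDl (p : U -> V -> W) u v w : bilinear_map p ->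
  p (u + v) w = p u w + p v w.
Proof. by move=> hp; have /= := hp.1 w 1 u v; rewrite !scale1r. Qed.

Lemma bilDr (p : U -> V -> W) u v w : bilinear_map p ->
  p w (u + v) = p w u + p w v.
Proof. by move=> hp; have /= := hp.2 w 1 u v; rewrite !scale1r. Qed.

(** With two products allowed, this covers both commutators and the Leibniz product made of [dr] and
    [dl]. *)
Lemma bilinear_sub (p : U -> V -> W) (q : V -> U -> W) :
  bilinear_map p -> bilinear_map q -> bilinear_map (fun u v => p u v - q v u).
Proof.
move=> hp hq; split=> [w|w] a u v /=.
  have /= -> := hp.1 w a u v; have /= -> := hq.2 w a u v.
  by rewrite scalerBr addrACA -opprD.
have /= -> := hp.2 w a u v; have /= -> := hq.1 w a u v.
by rewrite scalerBr addrACA -opprD.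
Qed.

End BilinearMaps.

(** Both copies of [r] change sign, so [r] and [- r] solve the same quadratic equations. *)
Lemma tsum2N (k : fieldType) (U V W : vectType k) (r : tensor U V)
    (F : U -> V -> U -> V -> W) :
  tsum2 (- r) F = tsum2 r F.
Proof.
have tliftNr (G : U -> V -> W) : tlift G (- r) = - tlift G r.
  by rewrite -scaleN1r tliftZ scaleN1r.
rewrite /tsum2 tliftNr -tliftN; apply: eq_tlift => u v.
by rewrite tliftNr opprK.
Qed.

Section Tmap.
Variables (k : fieldType) (U V U' V' : vectType k).
Implicit Types (f g : U -> U') (h l : V -> V').

Lemma tmapBl f g h t :
  tmap (fun u => f u - g u) h t = tmap f h t - tmap g h t.
Proof.
rewrite /tmap -tliftB; apply: eq_tlift => u v.
exact/bilBl/tpure_is_bilinear.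
Qed.

Lemma tmapDl f g h t :
  tmap (fun u => f u + g u) h t = tmap f h t + tmap g h t.
Proof.
rewrite /tmap -tliftD; apply: eq_tlift => u v.
exact/bilDl/tpure_is_bilinear.
Qed.

Lemma tmapBr f h l t :
  tmap f (fun v => h v - l v) t = tmap f h t - tmap f l t.
Proof.
rewrite /tmap -tliftB; apply: eq_tlift => u v.
exact/bilBr/tpure_is_bilinear.
Qed.

End Tmap.

(** * Triangular Lie bialgebras from triangular ASI bialgebras *)

Section TriangularLie.
Variables (k : fieldType) (A : vectType k) (I : finType) (x y : I -> A).
Let s : tensor A A := \sum_i x i ⊗ y i.

(** Renaming the summation indices in the reversed product swaps [phi] and [psi]. *)
Lemma prodsum_sub (p q : A -> A -> A) (phi psi chi : {scalar A}) :
  prodsum x y (fun u v => p u v - q v u) phi psi chi =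
  prodsum x y p phi psi chi - prodsum x y q psi phi chi.
Proof.
rewrite /prodsum [X in _ = _ - X]exchange_big -sumrB; apply: eq_bigr => i _ /=.
by rewrite -sumrB; apply: eq_bigr => j _; rewrite linearB /=; ring.
Qed.

Lemma lie_of_associative (mul : A -> A -> A) :
  associative_algebra mul -> lie_algebra (fun u v => mul u v - mul v u).
Proof.
case=> hm mA; split; first exact: bilinear_sub.
  by move=> u; rewrite subrr.
move=> u v w; rewrite !(bilBl _ _ _ hm, bilBr _ _ _ hm) !mA.
(* A linear form moves the identity into the field, where [ring] cancels the terms. *)
by apply: linear_form_eq => phi; rewrite !(linearD, linearN, linear0) /=; ring.
Qed.

(* [CYBE = AYBE - tau_23 AYBE] for skew-symmetric [s]. *)
Lemma classical_of_associative_YBE (mul : A -> A -> A) :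
  bilinear_map mul -> tensor_skew s -> associative_YBE mul s ->
  classical_YBE (fun u v => mul u v - mul v u) s.
Proof.
move=> hm hs ybe; rewrite /classical_YBE.
apply: (separating_eq (separating_tform (@separating_all _ _)
  (@separating_tensor _ _ _))).
case=> phi [psi chi] /=; rewrite linear0.
rewrite (classical_YBE_form _ _ _ (bilinear_sub hm hm) hs) !prodsum_sub.
have E a b c := associative_YBE_form a b c hm hs.
have := E phi psi chi; have := E phi chi psi.
rewrite [X in tform _ _ X]ybe [X in _ -> tform _ _ X = _ -> _]ybe !linear0.
move=> E1 E2; rewrite -[RHS]subr0 [X in _ = X - _]E2 [X in _ = _ - X]E1; ring.
Qed.

(** By skewness, subtracting the flip of [id ⊗ l - r ⊗ id] adds [l ⊗ id - id ⊗ r], and [l - r] is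
    the adjoint action. *)
Lemma lie_of_ASI_coboundary (mul : A -> A -> A) (t : tensor A A) a :
  bilinear_map mul -> tensor_skew t ->
  ASI_coboundary mul t a - tau (ASI_coboundary mul t a) =
  lie_coboundary (fun u v => mul u v - mul v u) t a.
Proof.
move=> hm ht; rewrite /ASI_coboundary /lie_coboundary linearB /=.
have ll : linear (mul a) by apply: hm.2.
have lr : linear (mul^~ a) by apply: hm.1.
have li : linear (@id A) by [].
rewrite -(tmap_tau _ ll li) -(tmap_tau _ li lr) ht !linearN /=.
rewrite tmapBr tmapBl opprD !opprK addrACA [RHS]addrACA; congr (_ + _).
by rewrite addrC.
Qed.

Lemma triangular_lie_of_ASI (X : bialgebra_data A) :
  is_triangular_ASI X s -> is_triangular_lie (lie_of_ASI X) s.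
Proof.
case=> hA hs ybe cob; have hm := assoc_bilinear hA; split=> //.
- exact: lie_of_associative.
- exact: classical_of_associative_YBE.
- by move=> a; rewrite /= cob; apply: lie_of_ASI_coboundary.
Qed.

End TriangularLie.

(** * Triangular Leibniz bialgebras from triangular diassociative bialgebras *)

Section TriangularLeibniz.
Variables (k : fieldType) (D : vectType k) (dl dr : D -> D -> D).
Variable hD : diassociative_algebra dl dr.

Let hl : bilinear_map dl := assoc_bilinear (dashv_assoc hD).
Let hr : bilinear_map dr := assoc_bilinear (vdash_assoc hD).
Let ast u v := dr u v - dl v u.

Lemma leibniz_of_diassociative_algebra : leibniz_algebra ast.
Proof.
split; first exact: bilinear_sub.
move=> u v w; rewrite /ast.
rewrite !(bilBl _ _ _ hl, bilBr _ _ _ hl, bilBl _ _ _ hr, bilBr _ _ _ hr).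
(* Oriented this way, the axioms reduce the eight products of three letters to three normal forms,
   one for each letter that the arrows can point to. *)
rewrite !(diass_vdash_dashv hD, diass_dashv_vdash_l hD) -!(diass_dashv_vdash hD).
rewrite !(assoc_mulA (vdash_assoc hD)) -!(assoc_mulA (dashv_assoc hD)).
by apply: linear_form_eq => phi; rewrite !(linearD, linearN, linear0) /=; ring.
Qed.

Section YangBaxter.
Variables (I : finType) (x y : I -> D).
Let r : tensor D D := \sum_i x i ⊗ y i.
Hypotheses (r_sym : tensor_symmetric r) (r_YBE : diassociative_YBE dl dr r).

Lemma diassociative_YBE_prodsum (phi psi chi : {scalar D}) :
  prodsum x y dr phi psi chi - prodsum x y dl chi phi psi
  - prodsum x y dr psi chi phi + prodsum x y dl psi chi phi = 0.
Proof.
rewrite -(diassociative_YBE_form _ _ _ hl hr r_sym) [X in tform _ _ X]r_YBE.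
exact: linear0.
Qed.

(* The Leibniz equation is the sum of two images of [r_YBE]: under a cyclic
   permutation of the legs and under the transposition of the first two. *)
Lemma leibniz_of_diassociative_YBE : leibniz_YBE ast r.
Proof.
apply: (separating_eq (separating_tform (@separating_all _ _)
  (@separating_tensor _ _ _))).
case=> phi [psi chi] /=; rewrite linear0 leibniz_YBE_form //; last first.
  exact: bilinear_sub.
rewrite !prodsum_sub.
have E1 := diassociative_YBE_prodsum psi chi phi.
have E2 := diassociative_YBE_prodsum psi phi chi.
by rewrite -[RHS]addr0 -[X in _ = X + _]E1 -[X in _ = _ + X]E2; ring.
Qed.

End YangBaxter.

(** By symmetry of [r] both sides act on [r] itself. The left and right actions of [ast] are
    [dr d - dl^~ d] and [dr^~ d - dl d], and the four one-sided actions recombine into them with the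
    opposite sign. *)
Lemma leibniz_of_diassociative_coboundary (r : tensor D D) d :
  tensor_symmetric r ->
  triangular_covdash dl dr r d - tau (triangular_codashv dl dr r d) =
  - leibniz_coboundary ast r d.
Proof.
move=> r_sym; rewrite /triangular_covdash /triangular_codashv /leibniz_coboundary.
have li : linear (@id D) by [].
have ldl : linear (dl d) by apply: hl.2.
have ldr : linear (dr d) by apply: hr.2.
have lrr : linear (dr^~ d) by apply: hr.1.
rewrite /ast tmapBl !tmapBr tmapDl !tmapBl !linearB /= -(tmap_tau _ ldr li).
rewrite -(tmap_tau _ ldl li) -(tmap_tau _ li lrr) r_sym.
by apply: linear_form_eq => phi; rewrite !(linearD, linearN) /=; ring.
Qed.

(** The coproduct of [L] is the coboundary of [- r], which is as symmetric as [r] and solves the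
    same equation. Reversing the sign of the coproduct gives the version with [r]. *)
Lemma triangular_leibniz_of_diassociative (I : finType) (x y : I -> D) :
  let r := \sum_i x i ⊗ y i in
  let L := leibniz_of_diassociative (triangular_dibialgebra dl dr r) in
  tensor_symmetric r -> diassociative_YBE dl dr r ->
  is_triangular_leibniz L (- r) /\
  is_triangular_leibniz
    (BialgebraData (bprod L) (leibniz_coboundary (bprod L) r)) r.
Proof.
move=> r L r_sym r_YBE; have hL := leibniz_of_diassociative_algebra.
have ybe : leibniz_YBE (bprod L) r := leibniz_of_diassociative_YBE r_sym r_YBE.
split; split=> //.
- by rewrite /tensor_symmetric linearN /= r_sym.
- by rewrite /leibniz_YBE tsum2N; apply: ybe.
- move=> d; rewrite /= leibniz_of_diassociative_coboundary //.
  by rewrite /leibniz_coboundary !linearN /= opprB opprK addrC.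
Qed.

End TriangularLeibniz.

(** * The algebra induced on [D ⊗ B] *)

Section TensorBilinear.
Variable k : fieldType.
Implicit Types A U V W : vectType k.

Lemma tliftP U V W (F G : U -> V -> W) a t :
  tlift (fun u v => a *: F u v + G u v) t = a *: tlift F t + tlift G t.
Proof.
by rewrite tliftD (linear_tlift (g := *:%R a)) // => b u v; exact: linearP.
Qed.

(** [tlift] extends values on basis vectors linearly, so bilinearity is automatic; values on pure
    tensors are left to [tlift2_tpure]. *)
Lemma tlift2_bilinear U V U' V' W (F : U -> V -> U' -> V' -> W) :
  bilinear_map (fun t t' => tlift (fun u v => tlift (F u v) t') t).
Proof.
split=> [t'|t] a t1 t2 /=; first exact: tlift_is_linear.
by rewrite -tliftP; apply: eq_tlift => u v; exact: tlift_is_linear.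
Qed.

Lemma tlift2_tpure U V U' V' W (F : U -> V -> U' -> V' -> W) u v u' v' :
  (forall u v, bilinear_map (F u v)) ->
  (forall u' v', bilinear_map (fun u v => F u v u' v')) ->
  tlift (fun u v => tlift (F u v) (u' ⊗ v')) (u ⊗ v) = F u v u' v'.
Proof.
move=> hF hF'.
rewrite (@eq_tlift _ _ _ _ _ (fun u v => F u v u' v')) ?tlift_tpure //.
by move=> a b; rewrite tlift_tpure.
Qed.

Lemma tensor_ext2 U V U' V' W (f g : tensor U V -> tensor U' V' -> W) :
  bilinear_map f -> bilinear_map g ->
  (forall u v u' v', f (u ⊗ v) (u' ⊗ v') = g (u ⊗ v) (u' ⊗ v')) -> f =2 g.
Proof.
move=> hf hg fg t t'.
apply: (@tensor_ext _ _ _ _ (f^~ t') (g^~ t')); [exact: hf.1|exact: hg.1|].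
move=> u v; apply: tensor_ext; [exact: hf.2|exact: hg.2|]; exact: fg.
Qed.

(** [tbullet] interleaves the legs, so a product test splits into a factor on [U] and a factor on
    [V]. *)
Lemma tform_tbullet U V (phi phi' : {scalar U}) (psi psi' : {scalar V}) s t :
  tform (tform phi psi) (tform phi' psi') (tbullet s t) =
  tform phi phi' s * tform psi psi' t.
Proof.
rewrite /tbullet tform_tlift [tform phi phi' s]/tform mulrC.
rewrite (linear_tlift (W := k^o) (W' := k^o) (g := *%R (tform psi psi' t)));
  last by move=> a u v; rewrite /GRing.scale /=; ring.
apply: (@eq_tlift _ _ _ k^o) => u u'; rewrite tform_tlift mulrC.
rewrite (linear_tlift (W := k^o) (W' := k^o) (g := *%R (phi u * phi' u')));
  last by move=> a v v'; rewrite /GRing.scale /=; ring.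
apply: (@eq_tlift _ _ _ k^o) => v v'; rewrite !tform_tpure /= !tform_tpure.
by ring.
Qed.

Lemma ASI_coboundary_linear A (mul : A -> A -> A) (s : tensor A A) :
  bilinear_map mul -> linear (ASI_coboundary mul s).
Proof.
move=> hm a u v; have bp := @tpure_is_bilinear k A A.
rewrite /ASI_coboundary scalerBr addrACA -opprD; congr (_ - _).
  rewrite /tmap -tliftP; apply: eq_tlift => x y.
  by rewrite (bilPl hm); exact: bp.2.
rewrite /tmap -tliftP; apply: eq_tlift => x y.
by rewrite (bilPr hm); exact: bp.1.
Qed.

End TensorBilinear.

Section InducedAlgebra.
Variables (k : fieldType) (D B : vectType k) (dl dr : D -> D -> D).
Variables (dia : B -> B -> B).
Hypotheses (hl : bilinear_map dl) (hr : bilinear_map dr).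
Hypothesis (hd : bilinear_map dia).

(** Convertible to the product of [ASI_of_diassociative]. *)
Definition tensor_mul (u v : tensor D B) : tensor D B :=
  tlift (fun d1 b1 => tlift (fun d2 b2 =>
    dr d1 d2 ⊗ dia b1 b2 + dl d1 d2 ⊗ dia b2 b1) v) u.

Let hP := (bilPl hl, bilPr hl, bilPl hr, bilPr hr, bilPl hd, bilPr hd).

Lemma tensor_mul_bilinear : bilinear_map tensor_mul.
Proof. exact: tlift2_bilinear. Qed.

Lemma tensor_mul_tpure d1 b1 d2 b2 :
  tensor_mul (d1 ⊗ b1) (d2 ⊗ b2) =
  dr d1 d2 ⊗ dia b1 b2 + dl d1 d2 ⊗ dia b2 b1.
Proof.
rewrite /tensor_mul tlift2_tpure // => d b; split=> ? a ? ? /=.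
all: apply: (separating_eq (@separating_tensor _ _ _)) => -[phi psi].
all: rewrite !hP !(linearD, scalarZ) /= !tform_tpure !linearP; ring.
Qed.

(** Triple products in [D] have three normal forms. Comparing their coefficients in [B] gives the
    Zinbiel identity for two of them, and for the middle one the symmetry of [dia a (dia b c)] in
    [a] and [b]. *)
Lemma tensor_mul_associative :
  diassociative_algebra dl dr -> zinbiel_algebra dia ->
  associative_algebra tensor_mul.
Proof.
move=> hD hB; have hm := tensor_mul_bilinear; split=> // u v w.
have lin1 v' w' : linear (fun u => tensor_mul u (tensor_mul v' w')).
  exact: hm.1.
have lin2 v' w' : linear (fun u => tensor_mul (tensor_mul u v') w').
  by move=> a t t'; rewrite !(bilPl hm).
apply: (@tensor_ext _ _ _ _ (fun u => tensor_mul u (tensor_mul v w))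
  (fun u => tensor_mul (tensor_mul u v) w)) => // d1 b1.
apply: (@tensor_ext2 _ _ _ _ _ _
  (fun v w => tensor_mul (d1 ⊗ b1) (tensor_mul v w))
  (fun v w => tensor_mul (tensor_mul (d1 ⊗ b1) v) w)).
- by split=> ? a t t' /=; rewrite !(bilPl hm, bilPr hm).
- by split=> ? a t t' /=; rewrite !(bilPl hm, bilPr hm).
move=> d2 b2 d3 b3; rewrite !tensor_mul_tpure.
rewrite (bilDl _ _ _ hm) (bilDr _ _ _ hm) !tensor_mul_tpure.
rewrite !(diass_vdash_dashv hD, diass_dashv_vdash_l hD) -!(diass_dashv_vdash hD).
rewrite !(assoc_mulA (vdash_assoc hD)) -!(assoc_mulA (dashv_assoc hD)).
apply: (separating_eq (@separating_tensor _ _ _)) => -[phi psi].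
rewrite !linearD /= !tform_tpure !(zinbiel_identity hB) !linearD /=; ring.
Qed.

End InducedAlgebra.

(** Collecting the terms of the commutator in [dia b1 b2] yields the Leibniz product. Dually,
    flipping both factors of [tbullet] moves the [tau] on [nu b] to [codashv], which yields the
    Leibniz coproduct. *)
Lemma lie_of_ASI_of_diassociative (k : fieldType) (D B : vectType k)
    (dia : B -> B -> B) (nu : B -> tensor B B) (X : dibialgebra_data D) :
  bilinear_map dia -> bilinear_map (dashv X) -> bilinear_map (vdash X) ->
  same_bialgebra (lie_of_ASI (ASI_of_diassociative dia nu X))
                 (lie_of_leibniz dia nu (leibniz_of_diassociative X)).
Proof.
move=> hd hl hr; pose hm := tensor_mul_bilinear (dashv X) (vdash X) dia.
have hP := (bilPl hl, bilPr hl, bilPl hr, bilPr hr, bilPl hd, bilPr hd).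
split=> [u v|t]; last first.
  rewrite /= [tau _](linear_tlift _ _ (@tau_is_linear _ _ _)) -tliftB.
  apply: eq_tlift => d b.
  apply: (separating_eq (separating_tform (@separating_tensor _ _ _)
    (@separating_tensor _ _ _))) => -[[phi psi] [phi' psi']].
  rewrite !(linearD, linearN) /= !tform_tau.
  rewrite !tform_tbullet !(linearD, linearN) /= !tform_tau; ring.
apply: tensor_ext2 u v.
- exact: (bilinear_sub hm hm).
- exact: tlift2_bilinear.
move=> d1 b1 d2 b2; rewrite /= !tlift2_tpure.
- apply: (separating_eq (@separating_tensor _ _ _)) => -[phi psi].
  by rewrite !(linearD, linearN) /= !tform_tpure !(linearD, linearN) /=; ring.
all: move=> d b; split=> ? a ? ? /=.
all: apply: (separating_eq (@separating_tensor _ _ _)) => -[phi psi].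
all: rewrite !hP !(linearD, linearN, scalarZ) /= !tform_tpure.
all: rewrite !(linearD, linearN, scalarZ) /=; ring.
Qed.

(** * Quadratic Zinbiel algebras and the lifted solution *)

Lemma triangular_lie_same (k : fieldType) (L : vectType k)
    (X Y : bialgebra_data L) (s : tensor L L) :
  same_bialgebra X Y -> is_triangular_lie X s -> is_triangular_lie Y s.
Proof.
case=> eqp eqc [[hb alt jac] sk ybe cob]; split=> //.
- split.
  + by split=> w a u v /=; rewrite -!eqp; [exact: hb.1|exact: hb.2].
  + by move=> u; rewrite -eqp.
  + by move=> u v w; rewrite -!eqp.
- rewrite /classical_YBE -ybe; apply: eq_tlift => u v.
  by apply: eq_tlift => u' v'; rewrite -!eqp.
- move=> g; rewrite -eqc cob /lie_coboundary.
  by congr (_ + _); apply: eq_tlift => u v; rewrite eqp.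
Qed.

(** Separates the sum over [r] from the sum over the dual bases. *)
Lemma sum_pair_mul (R : comNzRingType) (I J : finType) (f : I -> R) (g : J -> R) :
  \sum_ij f ij.1 * g ij.2 = (\sum_i f i) * (\sum_j g j).
Proof.
by rewrite big_distrlr /= pair_bigA.
Qed.

Lemma sum2_pair_mul (R : comNzRingType) (I J : finType)
    (f : I -> I -> R) (g : J -> J -> R) :
  \sum_ij \sum_kl f ij.1 kl.1 * g ij.2 kl.2 =
  (\sum_i \sum_k f i k) * (\sum_j \sum_l g j l).
Proof.
rewrite -sum_pair_mul; apply: eq_bigr => ij _.
exact: (sum_pair_mul (f ij.1) (g ij.2)).
Qed.

Lemma scalar_combination (k : fieldType) (V : vectType k) (alpha : V -> k)
    (I : finType) (c : I -> k) (v : I -> V) :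
  scalar alpha -> alpha (\sum_i c i *: v i) = \sum_i c i * alpha (v i).
Proof.
move=> la; pose f := GRing.isLinear.Build k V k *%R alpha la.
pose g : {scalar V} := HB.pack alpha f.
change (g (\sum_i c i *: v i) = \sum_i c i * g (v i)).
by rewrite linear_sum; apply: eq_bigr => i _; rewrite scalarZ.
Qed.

Section Quadratic.
Variables (k : fieldType) (B : vectType k).
Variables (dia : B -> B -> B) (w : B -> B -> k).
Hypothesis hB : quadratic_zinbiel_algebra dia w.

Let hw : bilinear_form w := form_bilinear hB.
Let hd : bilinear_map dia := zinbiel_bilinear (quadratic_zinbiel hB).

(* The unused proof argument is what the linearity instance below needs. *)
Definition rform (_ : quadratic_zinbiel_algebra dia w) (a b : B) : k := w b a.

Lemma rform_is_linear h a : scalar (rform h a).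
Proof. exact: (form_bilinear h).1. Qed.

HB.instance Definition _ h a :=
  GRing.isLinear.Build k B k *%R (rform h a) (rform_is_linear h a).

Lemma separating_rform : separating (fun a => rform hB a : {scalar B}).
Proof. by move=> b b0; apply: (form_nondegenerate hB) => a; apply: b0. Qed.

(** By invariance both sides are [w b (dia a c + dia c a)]. *)
Lemma rform_dia_swap a b c :
  rform hB c (dia a b) = rform hB a (dia c b).
Proof.
by rewrite /rform !(form_invariant hB) addrC.
Qed.

Lemma rform_dia_cyclic a b c :
  rform hB c (dia a b) + rform hB b (dia a c) + rform hB b (dia c a) = 0.
Proof.
rewrite /rform (form_invariant hB).
have -> : w b (dia a c + dia c a) = w b (dia a c) + w b (dia c a).
  by have := hw.2 b 1 (dia a c) (dia c a); rewrite /= scale1r mul1r.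
by rewrite !(form_skew hB b); ring.
Qed.

Lemma tform_dual_coproduct nu a b c : dual_coproduct dia w nu ->
  tform (rform hB b) (rform hB c) (nu a) = - rform hB a (dia b c).
Proof.
move=> hnu; rewrite /rform -(form_skew hB) -hnu.
apply: (@eq_tlift _ _ _ k^o) => u v; rewrite tlift_tpure //.
by apply: scalar_bilinear; exact: hw.2.
Qed.

(** * Dual bases and the Casimir element of [w] *)

Section Casimir.
Variables (m : nat) (e f : m.-tuple B).
Hypotheses (he : basis_of fullv e)
  (hef : forall i j, w (tnth f i) (tnth e j) = (i == j)%:R).
Local Notation E := (tnth e).
Local Notation F := (tnth f).

Lemma dual_basis_expansion v : v = \sum_p w (F p) v *: E p.
Proof.
have cv := coord_basis he (memvf v); rewrite [LHS]cv.
apply: eq_bigr => i _; rewrite -tnth_nth; congr (_ *: _).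
rewrite [in RHS]cv (scalar_combination _ _ (hw.2 (F i))).
rewrite (bigD1 i) //= big1 => [|j ji].
  by rewrite -tnth_nth hef eqxx mulr1 addr0.
by rewrite -tnth_nth hef eq_sym (negPf ji) mulr0.
Qed.

(** Nondegeneracy lets both sides be tested against [b], which is then expanded in [e]; the sign is
    that of the skew form. *)
Lemma dual_basis_expansion' v : v = - \sum_p w (E p) v *: F p.
Proof.
apply: (separating_eq separating_rform) => b; rewrite linearN /=.
rewrite (scalar_combination _ _ (rform_is_linear hB b)) /rform.
rewrite [b in LHS]dual_basis_expansion (scalar_combination _ _ (hw.2 v)).
rewrite -sumrN; apply: eq_bigr => p _; rewrite (form_skew hB v); ring.
Qed.

Lemma casimir_suml (alpha : B -> k) v : scalar alpha ->
  \sum_p alpha (E p) * w (F p) v = alpha v.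
Proof.
move=> la; rewrite [v in RHS]dual_basis_expansion (scalar_combination _ _ la).
by apply: eq_bigr => p _; rewrite mulrC.
Qed.

Lemma casimir_sumr (alpha : B -> k) v : scalar alpha ->
  \sum_p w (E p) v * alpha (F p) = - alpha v.
Proof.
move=> la; rewrite [v in RHS]dual_basis_expansion' -sumrN.
under [in RHS]eq_bigr do rewrite -scaleNr.
by rewrite (scalar_combination _ _ la) -sumrN; apply: eq_bigr => p _; ring.
Qed.

(** The Casimir element is skew: expand [alpha (E p)] along [f], exchange the sums, and resum over
    [p] with [beta]. *)
Lemma casimir_skew (alpha beta : B -> k) : scalar alpha -> scalar beta ->
  \sum_p alpha (E p) * beta (F p) = - \sum_p alpha (F p) * beta (E p).
Proof.
move=> la lb.
transitivity (\sum_p \sum_q - (w (E q) (E p) * alpha (F q) * beta (F p))).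
  apply: eq_bigr => p _; rewrite sumrN -mulr_suml (casimir_sumr _ la).
  by rewrite mulNr opprK.
rewrite exchange_big -sumrN; apply: eq_bigr => q _ /=.
rewrite -[beta (E q)]opprK -(casimir_sumr (E q) lb) mulrN opprK mulr_sumr.
by apply: eq_bigr => p _; rewrite (form_skew hB (E q)); ring.
Qed.

Lemma casimir_sum2 (beta : B -> B -> k) a b : bilinear_form beta ->
  \sum_p \sum_q beta (E p) (E q) * w (F p) a * w (F q) b = beta a b.
Proof.
move=> hb; rewrite -(casimir_suml a (hb.1 b)).
apply: eq_bigr => p _; rewrite -(casimir_suml b (hb.2 (E p))) mulr_suml.
by apply: eq_bigr => q _; ring.
Qed.

(** * The lifted solution on the tensor product of [D] and [B] *)

Section Lifted.
Variables (D : vectType k) (n : nat) (x y : 'I_n -> D).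

(** Pairs as indices give the lifted tensor the single-sum shape that [prodsum] works with. *)
Definition lifted_left (ij : 'I_n * 'I_m) : tensor D B := x ij.1 ⊗ E ij.2.
Definition lifted_right (ij : 'I_n * 'I_m) : tensor D B := y ij.1 ⊗ F ij.2.

Let r : tensor D D := \sum_i x i ⊗ y i.
Let rt : tensor (tensor D B) (tensor D B) :=
  \sum_ij lifted_left ij ⊗ lifted_right ij.

Lemma separating_lifted :
  separating (fun ij : {scalar D} * B =>
    tform ij.1 (rform hB ij.2) : {scalar tensor D B}).
Proof. exact: (separating_tform (@separating_all _ D) separating_rform). Qed.

(** A symmetric tensor interleaved with the skew Casimir element is skew: [flip_legs] reverses the
    part in [D], [casimir_skew] the part in [B]. *)
Lemma lifted_skew : tensor_symmetric r -> tensor_skew rt.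
Proof.
move=> r_sym; have r_sym1 : tau r = 1 *: r by rewrite scale1r.
apply: (separating_eq (separating_tform separating_lifted separating_lifted)).
case=> -[phi a] [psi b]; rewrite /= tform_tau linearN /= !linear_sum /=.
rewrite /lifted_left /lifted_right -sumrN.
under eq_bigr do rewrite !tform_tpure /= !tform_tpure /=.
transitivity ((\sum_i psi (x i) * phi (y i)) * \sum_p w (E p) b * w (F p) a).
  by rewrite -sum_pair_mul; apply: eq_bigr => ij _; rewrite /rform /=; ring.
have := flip_legs r_sym1 (scalarP phi) (scalarP psi); rewrite mul1r => r_flip.
under eq_bigr do rewrite mulrC; rewrite r_flip.
rewrite (casimir_skew (rform_is_linear hB b) (rform_is_linear hB a)) mulrN.
rewrite -sum_pair_mul -sumrN; apply: eq_bigr => ij _.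
by rewrite !tform_tpure /= !tform_tpure /= /rform; ring.
Qed.

Variables (dl dr : D -> D -> D).
Hypothesis hD : diassociative_algebra dl dr.

Let hl : bilinear_map dl := assoc_bilinear (dashv_assoc hD).
Let hr : bilinear_map dr := assoc_bilinear (vdash_assoc hD).
Let mul := tensor_mul dl dr dia.

(** The second legs [F p] and [F q] are paired with [a] and [b], so summing over the dual bases puts
    [a] and [b] in place of [E p] and [E q] inside the product of [B]. *)
Lemma prodsum_lifted (phi psi chi : {scalar D}) a b c :
  prodsum lifted_left lifted_right mul (tform phi (rform hB a))
    (tform psi (rform hB b)) (tform chi (rform hB c)) =
  rform hB c (dia a b) * prodsum x y dr phi psi chi +
  rform hB c (dia b a) * prodsum x y dl phi psi chi.
Proof.
have bil_c : bilinear_form (fun u v => rform hB c (dia u v)).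
  by split=> v t u u' /=; rewrite ?(bilPl hd) ?(bilPr hd) linearP.
have bil_c' : bilinear_form (fun u v => rform hB c (dia v u)).
  by split=> v t u u' /=; rewrite ?(bilPl hd) ?(bilPr hd) linearP.
rewrite -[rform hB c (dia a b)](casimir_sum2 a b bil_c).
rewrite -[rform hB c (dia b a)](casimir_sum2 a b bil_c').
rewrite ![_ * prodsum _ _ _ _ _ _]mulrC -!sum2_pair_mul -big_split /=.
apply: eq_bigr => ij _; rewrite -big_split; apply: eq_bigr => kl _ /=.
rewrite /mul /lifted_left /lifted_right (tensor_mul_tpure hl hr hd) linearD /=.
by rewrite !tform_tpure /= /rform; ring.
Qed.

Lemma lifted_associative_YBE :
  tensor_symmetric r -> diassociative_YBE dl dr r -> associative_YBE mul rt.
Proof.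
move=> r_sym ybe; apply: (separating_eq (separating_tform separating_lifted
  (separating_tform separating_lifted separating_lifted))).
case=> -[phi a] [[psi b] [chi c]]; rewrite linear0 /=.
rewrite (associative_YBE_form _ _ _ (tensor_mul_bilinear _ _ _)); last first.
  exact: lifted_skew.
rewrite !prodsum_lifted.
(* Of six coefficients three remain, exactly those whose sum vanishes by [rform_dia_cyclic]. *)
rewrite (rform_dia_swap b c a) (rform_dia_swap c b a) (rform_dia_swap b a c).
(* The form of [B] leaves a combination of the given equation and of its image
   under a cyclic permutation of the legs. *)
transitivity (- rform hB b (dia a c) *
    (prodsum x y dr phi psi chi - prodsum x y dl chi phi psi -
     prodsum x y dr psi chi phi + prodsum x y dl psi chi phi) +
  rform hB b (dia c a) *
    (prodsum x y dr chi phi psi - prodsum x y dl psi chi phi -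
     prodsum x y dr phi psi chi + prodsum x y dl phi psi chi) +
  (rform hB c (dia a b) + rform hB b (dia a c) + rform hB b (dia c a)) *
    (prodsum x y dl psi chi phi + prodsum x y dr phi psi chi)); first by ring.
rewrite !(diassociative_YBE_prodsum hD r_sym ybe) rform_dia_cyclic.
by rewrite !mulr0 mul0r !addr0.
Qed.

(** On pure tensors both sides become sums over [r] with coefficients in the form of [B]; once the
    dual bases are summed away, invariance matches the coefficients. *)
Lemma lifted_coboundary (nu : B -> tensor B B) t :
  dual_coproduct dia w nu ->
  tlift (fun d b => tbullet (triangular_covdash dl dr r d) (nu b) +
    tbullet (triangular_codashv dl dr r d) (tau (nu b))) t =
  ASI_coboundary mul rt t.
Proof.
move=> hnu; have hm := tensor_mul_bilinear dl dr dia.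
rewrite (linear_tensor t (ASI_coboundary_linear rt hm)); apply: eq_tlift => d b.
apply: (separating_eq (separating_tform separating_lifted separating_lifted)).
case=> -[phi a] [psi c]; rewrite linearD /= !tform_tbullet tform_tau.
rewrite !tform_dual_coproduct //.
rewrite /triangular_covdash /triangular_codashv /ASI_coboundary.
rewrite tmapBl tmapBr !(linearB, linearN, linearD) /= !tform_tmap.
rewrite !tlift_mul_sum; try by [exact: scalarP |
  exact: scalar_mull | exact: scalar_mulr].
(* [E p] is paired with [a], so [casimir_sumr] replaces [F p] in the product by [- a]. *)
have suml : \sum_i tform phi (rform hB a) (lifted_left i) *
    tform psi (rform hB c) (tensor_mul dl dr dia (d ⊗ b) (lifted_right i)) =
  - ((\sum_i phi (x i) * psi (dr d (y i))) * rform hB c (dia b a) +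
     (\sum_i phi (x i) * psi (dl d (y i))) * rform hB c (dia a b)).
  rewrite opprD -!mulrN -(casimir_sumr a (scalar_mulr hd (rform hB c) b)).
  rewrite -(casimir_sumr a (scalar_mull hd (rform hB c) b)) -!sum_pair_mul.
  rewrite -big_split; apply: eq_bigr => ij _ /=.
  rewrite /lifted_left /lifted_right (tensor_mul_tpure hl hr hd) linearD /=.
  by rewrite !tform_tpure /= /rform; ring.
(* [F p] is paired with [c], so [casimir_suml] replaces [E p] in the product by [c], without a
   sign. *)
have sumr : \sum_i tform phi (rform hB a)
    (tensor_mul dl dr dia (lifted_left i) (d ⊗ b)) *
    tform psi (rform hB c) (lifted_right i) =
  (\sum_i phi (dr (x i) d) * psi (y i)) * rform hB a (dia c b) +
  (\sum_i phi (dl (x i) d) * psi (y i)) * rform hB a (dia b c).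
  rewrite -(casimir_suml c (scalar_mull hd (rform hB a) b)).
  rewrite -(casimir_suml c (scalar_mulr hd (rform hB a) b)) -!sum_pair_mul.
  rewrite -big_split; apply: eq_bigr => ij _ /=.
  rewrite /lifted_left /lifted_right (tensor_mul_tpure hl hr hd) linearD /=.
  by rewrite !tform_tpure /= /rform; ring.
(* Everything is reduced to [rform hB b (dia a c)] and [rform hB b (dia c a)], the values coming
   from [nu b] and its flip. *)
rewrite suml sumr (rform_dia_swap b a c) (rform_dia_swap c b a).
rewrite (rform_dia_swap b c a).
have -> : rform hB c (dia a b) = - rform hB b (dia a c) - rform hB b (dia c a).
  by apply/eqP; rewrite -subr_eq0 opprD !opprK addrA rform_dia_cyclic.
ring.
Qed.

End Lifted.
End Casimir.
End Quadratic.

(** * Assembling the square of constructions *)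

Unset Implicit Arguments.

Theorem corollary5p24 (k : fieldType) (char0 : [pchar k] =i pred0)
  (D B : vectType k)
  (dl dr : D -> D -> D) (hD : diassociative_algebra dl dr)
  (n : nat) (x y : 'I_n -> D) (r : tensor D D)
  (r_def : r = \sum_i x i ⊗ y i)
  (r_sym : tensor_symmetric r)
  (r_YBE : diassociative_YBE dl dr r)
  (dia : B -> B -> B) (w : B -> B -> k)
  (hB : quadratic_zinbiel_algebra dia w)
  (nu : B -> tensor B B) (hnu : dual_coproduct dia w nu)
  (m : nat) (e f : m.-tuple B)
  (he : basis_of fullv e)
  (hf : forall i j : 'I_m, w (tnth f i) (tnth e j) = (i == j)%:R) :
  let X := triangular_dibialgebra dl dr r in
  let rt : tensor (tensor D B) (tensor D B) :=
    \sum_(i < n) \sum_(j < m) (x i ⊗ tnth e j) ⊗ (y i ⊗ tnth f j) in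
  let A := ASI_of_diassociative dia nu X in
  let L := leibniz_of_diassociative X in
  [/\ is_triangular_ASI A rt,
      is_triangular_lie (lie_of_ASI A) rt,
      is_triangular_leibniz L (- r) /\
        is_triangular_leibniz
          (BialgebraData (bprod L) (leibniz_coboundary (bprod L) r)) r,
      is_triangular_lie (lie_of_leibniz dia nu L) rt &
      same_bialgebra (lie_of_ASI A) (lie_of_leibniz dia nu L)].
Proof.
subst r; move=> X rt A L.
have hl : bilinear_map dl := assoc_bilinear (dashv_assoc hD).
have hr : bilinear_map dr := assoc_bilinear (vdash_assoc hD).
have hz := quadratic_zinbiel hB; have hd := zinbiel_bilinear hz.
pose s : tensor (tensor D B) (tensor D B) :=
  \sum_ij lifted_left e x ij ⊗ lifted_right f y ij.
have -> : rt = s by rewrite /rt pair_bigA.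
have triA : is_triangular_ASI A s.
  split.
  - exact: tensor_mul_associative.
  - exact: (lifted_skew hB).
  - exact: (lifted_associative_YBE hB).
  - by move=> t; apply: (lifted_coboundary hB).
have triLie := triangular_lie_of_ASI triA.
have same : same_bialgebra (lie_of_ASI A) (lie_of_leibniz dia nu L).
  exact: lie_of_ASI_of_diassociative.
split=> //; first exact: triangular_leibniz_of_diassociative.
(* The route through Leibniz bialgebras inherits triangularity, with the same [rt], from the route
   through ASI bialgebras. *)
exact: triangular_lie_same same triLie.
Qed.
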